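(* Let $M$ be a positive integer, $\alpha\in\mathbb{R}$, $A\in\mathbb{C}^{M\times M}$ Hermitian, and let $\mathcal{F}(X)=\tfrac12 X^*AX+\alpha\sum_{j=1}^M|X_j|^4$ for $X\in\mathbb{C}^M$. Consider the problem of minimizing $\mathcal{F}(X)$ subject to $\|X\|_2=1$. Let $\{X^{(k)}:k\ge 0\}$ be an infinite sequence generated by the regularized Newton method described in the context (run without stopping). Then either $\|\mathcal{A}(X^{(k)})X^{(k)}\|_2=0$ for some finite $k$, or $$\lim_{k\to\infty}\|\mathcal{A}(X^{(k)})X^{(k)}\|_2=0,$$ where $\mathcal{A}(X)=GX^*-XG^*$ with $G=\nabla\mathcal{F}(X)$.
   Context: Notation. $X^*$ is the complex conjugate transpose, $\bar X_j$ the complex conjugate, $\Re$ the real part, and $\|X\|_2^2=\sum_{j=1}^M|X_j|^2$. The first and second directional derivatives of $\mathcal{F}$ at $X$ along $D\in\mathbb{C}^M$ (with $\mathbb{C}^M$ viewed as a real vector space) are $$\nabla\mathcal{F}(X)[D]=\Re(D^*AX)+4\alpha\sum_{j=1}^M|X_j|^2\,\Re(\bar X_jD_j),$$ $$\nabla^2\mathcal{F}(X)[D,D]=D^*AD+4\alpha\sum_{j=1}^M\left[|X_j|^2|D_j|^2+2\big(\Re(\bar X_jD_j)\big)^2\right].$$ The gradient $G=\nabla\mathcal{F}(X)\in\mathbb{C}^M$ is the vector with $\nabla\mathcal{F}(X)[D]=\Re(D^*G)$ for all $D$, i.e. $G_j=(AX)_j+4\alpha|X_j|^2X_j$. The first-order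 optimality condition of the constrained problem is $\mathcal{A}(X)X=0$, $\|X\|_2=1$. Regularized Newton method. Fix constants $0<\eta_1\le\eta_2<1$ and $1<\gamma_1\le\gamma_2$. Start from a feasible point $X^{(0)}$ ($\|X^{(0)}\|_2=1$) and an initial regularization parameter $\delta^{(0)}>0$. An initial phase, which minimizes $\mathcal{F}$ over the unit sphere to a certain low accuracy by a feasible (norm-preserving) gradient method started at $X^{(0)}$, returns a feasible point $X^{(1)}$ ($\|X^{(1)}\|_2=1$); set $\delta^{(1)}=\delta^{(0)}$. For $k=1,2,\dots$: 1. Define the model $$W^{(k)}(X)=\nabla\mathcal{F}(X^{(k)})[X-X^{(k)}]+\tfrac12\nabla^2\mathcal{F}(X^{(k)})[X-X^{(k)},X-X^{(k)}]+\tfrac{\delta^{(k)}}{2}\|X-X^{(k)}\|_2^2$$ (the algorithm uses it only up to an additive constant independent of $X$), and let $Z^{(k)}$ be an optimal solution of $\min_{\|X\|_2=1}W^{(k)}(X)$. 2. Compute the ratio $$\rho^{(k)}=\frac{\mathcal{F}(Z^{(k)})-\mathcal{F}(X^{(k)})}{W^{(k)}(Z^{(k)})-W^{(k)}(X^{(k)})}.$$ 3. Set $X^{(k+1)}=Z^{(k)}$ if $\rho^{(k)}\ge\eta_1$, and $X^{(k+1)}=X^{(k)}$ otherwise. 4. Choose $\delta^{(k+1)}$ (any value in the indicated interval) with $$\delta^{(k+1)}\in\begin{cases}(0,\delta^{(k)}],&\rho^{(k)}>\eta_2,\\ [\delta^{(k)},\gamma_1\delta^{(k)}],&\eta_1\le\rho^{(k)}\le\eta_2,\\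 [\gamma_1\delta^{(k)},\gamma_2\delta^{(k)}],&\text{otherwise.}\end{cases}$$ *)

(* Defs.v *)
From mathcomp Require Import all_boot all_order all_algebra.
From mathcomp Require Import complex.
From mathcomp Require Import all_classical all_reals all_analysis.
From mathcomp Require Import ring.

Set Implicit Arguments.
Unset Strict Implicit.
Unset Printing Implicit Defensive.

Import Order.TTheory GRing.Theory Num.Theory.
Import numFieldNormedType.Exports.
Import Normc.

Local Open Scope classical_set_scope.
Local Open Scope sesquilinear_scope.
Local Open Scope complex_scope.
Local Open Scope ring_scope.

Definition l2norm (R : realType) (n : nat) (X : 'cV[R[i]]_n) : R :=
  Num.sqrt (\sum_(j < n) normc (X j 0) ^+ 2).

(* For Hermitian [A] the number [X^* A X] is real, so that taking its real part
   only changes its type from [R[i]] to [R]. *)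
Definition objective (R : realType) (n : nat) (A : 'M[R[i]]_n) (alpha : R)
    (X : 'cV[R[i]]_n) : R :=
  2^-1 * complex.Re ((X^t* *m A *m X) 0 0)
  + alpha * \sum_(j < n) normc (X j 0) ^+ 4.

(* Directional derivatives with C^n viewed as a real vector space: the
   parameter [t] ranges over [R]. *)
Definition dirD (R : realType) (n : nat) (f : 'cV[R[i]]_n -> R)
    (X D : 'cV[R[i]]_n) : R :=
  derive1 (fun t : R => f (X + t%:C *: D)) 0.

Definition dirD2 (R : realType) (n : nat) (f : 'cV[R[i]]_n -> R)
    (X D : 'cV[R[i]]_n) : R :=
  derive1n 2 (fun t : R => f (X + t%:C *: D)) 0.

(* The vector representing [dirD (objective A alpha) X] for the real inner
   product Re(D^* G), see [dirD_objective_grad]. *)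
Definition grad (R : realType) (n : nat) (A : 'M[R[i]]_n) (alpha : R)
    (X : 'cV[R[i]]_n) : 'cV[R[i]]_n :=
  \col_j ((A *m X) j 0 + (4 * alpha * normc (X j 0) ^+ 2)%:C * X j 0).

Definition calA (R : realType) (n : nat) (A : 'M[R[i]]_n) (alpha : R)
    (X : 'cV[R[i]]_n) : 'M[R[i]]_n :=
  grad A alpha X *m X^t* - X *m (grad A alpha X)^t*.

Definition model (R : realType) (n : nat) (A : 'M[R[i]]_n) (alpha : R)
    (Xk : 'cV[R[i]]_n) (deltak : R) (X : 'cV[R[i]]_n) : R :=
  dirD (objective A alpha) Xk (X - Xk)
  + 2^-1 * dirD2 (objective A alpha) Xk (X - Xk)
  + deltak / 2 * l2norm (X - Xk) ^+ 2.

(* If the denominator vanishes, this is [0] by the convention [x / 0 = 0]; then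
   [Xk] itself minimizes the model over the sphere whenever [Z] does, so that
   [Xk] is a first-order point. *)
Definition ratio (R : realType) (n : nat) (A : 'M[R[i]]_n) (alpha : R)
    (Xk : 'cV[R[i]]_n) (deltak : R) (Z : 'cV[R[i]]_n) : R :=
  (objective A alpha Z - objective A alpha Xk)
  / (model A alpha Xk deltak Z - model A alpha Xk deltak Xk).

Definition sphere_argmin (R : realType) (n : nat) (f : 'cV[R[i]]_n -> R)
    (Z : 'cV[R[i]]_n) : Prop :=
  l2norm Z = 1 /\ forall Y : 'cV[R[i]]_n, l2norm Y = 1 -> f Z <= f Y.

(* [X], [Z], [delta] are the iterates, the model minimizers and the
   regularization parameters of an infinite run.  The initial phase, an
   unspecified feasible method leading from [X 0] to [X 1], is constrained only
   by the feasibility of its output. [Z 0] is unused. *)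
Record newton_run (R : realType) (n : nat) (A : 'M[R[i]]_n)
    (alpha eta1 eta2 gamma1 gamma2 : R)
    (X Z : nat -> 'cV[R[i]]_n) (delta : nat -> R) : Prop := NewtonRun {
  run_X0 : l2norm (X 0%N) = 1;
  run_delta0 : 0 < delta 0%N;
  run_X1 : l2norm (X 1%N) = 1;
  run_delta1 : delta 1%N = delta 0%N;
  run_Z : forall k, (1 <= k)%N ->
    sphere_argmin (model A alpha (X k) (delta k)) (Z k);
  run_X : forall k, (1 <= k)%N ->
    X k.+1 = if eta1 <= ratio A alpha (X k) (delta k) (Z k)
             then Z k else X k;
  run_delta : forall k, (1 <= k)%N ->
    let rho := ratio A alpha (X k) (delta k) (Z k) in
    if eta2 < rho then 0 < delta k.+1 <= delta k
    else if eta1 <= rho then delta k <= delta k.+1 <= gamma1 * delta k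
    else gamma1 * delta k <= delta k.+1 <= gamma2 * delta k
}.

Lemma sqr_normc (R : realType) (z : R[i]) :
  normc z ^+ 2 = complex.Re z ^+ 2 + complex.Im z ^+ 2.
Proof. by case: z => a b /=; rewrite sqr_sqrtr// addr_ge0// sqr_ge0. Qed.

Lemma sqr_normc_line (R : realType) (x d : R[i]) (t : R) :
  normc (x + t%:C * d) ^+ 2 =
    normc x ^+ 2 + 2 * complex.Re (x^* * d) * t + normc d ^+ 2 * t ^+ 2.
Proof. by rewrite !sqr_normc; case: x d => [a b] [c e] /=; ring. Qed.

Lemma Re_form_sym (R : realType) (n : nat) (A : 'M[R[i]]_n)
    (X D : 'cV[R[i]]_n) : A \is hermsymmx ->
  complex.Re ((X^t* *m A *m D) 0 0) = complex.Re ((D^t* *m A *m X) 0 0).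
Proof.
move=> /is_hermitianmxP; rewrite expr0 scale1r => hA.
have -> : D^t* *m A *m X = (X^t* *m A *m D)^t*.
  rewrite !trmx_mul !map_mxM /= -mulmxA; congr (_ *m _).
  rewrite [in LHS]hA; congr (_ *m _).
  by apply/matrixP => i j; rewrite !mxE conjCK.
by rewrite !mxE; case: (\sum_(_ < _) _).
Qed.

Lemma form_line (R : realType) (n : nat) (A : 'M[R[i]]_n)
    (X D : 'cV[R[i]]_n) (t : R) : A \is hermsymmx ->
  complex.Re (((X + t%:C *: D)^t* *m A *m (X + t%:C *: D)) 0 0) =
    complex.Re ((X^t* *m A *m X) 0 0)
    + 2 * complex.Re ((D^t* *m A *m X) 0 0) * t
    + complex.Re ((D^t* *m A *m D) 0 0) * t ^+ 2.
Proof.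
move=> hA.
have -> : (X + t%:C *: D)^t* = X^t* + t%:C *: D^t*.
  apply/matrixP => i j; rewrite !mxE rmorphD rmorphM /=; congr (_ + _ * _).
  by apply/eqP; rewrite eq_complex /= oppr0 !eqxx.
rewrite !mulmxDl !mulmxDr -!scalemxAl -!scalemxAr.
have ReM (z : R[i]) : complex.Re (t%:C * z) = t * complex.Re z.
  by case: z => a b /=; ring.
have ReD (z w : R[i]) : complex.Re (z + w) = complex.Re z + complex.Re w.
  by case: z w => [? ?] [].
move: (Re_form_sym X D hA).
move: (X^t* *m A *m X) (X^t* *m A *m D) (D^t* *m A *m X) (D^t* *m A *m D).
move=> a b c d hbc.
by rewrite !(mxE, ReD, ReM) hbc; ring.
Qed.

Lemma objective_line (R : realType) (n : nat) (A : 'M[R[i]]_n) (alpha : R)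
    (X D : 'cV[R[i]]_n) : A \is hermsymmx ->
  exists q : {poly R},
    (fun t : R => objective A alpha (X + t%:C *: D)) =
    horner ((objective A alpha X)%:P
      + (complex.Re ((D^t* *m A *m X) 0 0)
         + 4 * alpha * \sum_(j < n) normc (X j 0) ^+ 2
                                   * complex.Re ((X j 0)^* * D j 0))%:P * 'X
      + (2^-1 * (complex.Re ((D^t* *m A *m D) 0 0)
         + 4 * alpha * \sum_(j < n)
             (normc (X j 0) ^+ 2 * normc (D j 0) ^+ 2
              + 2 * complex.Re ((X j 0)^* * D j 0) ^+ 2)))%:P * 'X^2
      + q * 'X^3).
Proof.
move=> hA.
exists ((4 * alpha * \sum_(j < n) normc (D j 0) ^+ 2
           * complex.Re ((X j 0)^* * D j 0))%:P
        + (alpha * \sum_(j < n) normc (D j 0) ^+ 4)%:P * 'X).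
apply/funext => t; rewrite /objective form_line// !(hornerD, hornerM, hornerC, hornerXn, hornerX).
have -> : \sum_(j < n) normc ((X + t%:C *: D) j 0) ^+ 4 =
   \sum_(j < n) normc (X j 0) ^+ 4
   + 4 * t * (\sum_(j < n) normc (X j 0) ^+ 2
                           * complex.Re ((X j 0)^* * D j 0))
   + 2 * t ^+ 2 * (\sum_(j < n) (normc (X j 0) ^+ 2 * normc (D j 0) ^+ 2
              + 2 * complex.Re ((X j 0)^* * D j 0) ^+ 2))
   + 4 * t ^+ 3 * (\sum_(j < n) normc (D j 0) ^+ 2
           * complex.Re ((X j 0)^* * D j 0))
   + t ^+ 4 * \sum_(j < n) normc (D j 0) ^+ 4.
  rewrite !mulr_sumr -!big_split /=; apply: eq_bigr => j _.
  by rewrite !mxE -[4%N]/(2 * 2)%N exprM sqr_normc_line !exprM; ring.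
by field.
Qed.

Lemma dirD_objective (R : realType) (n : nat) (A : 'M[R[i]]_n) (alpha : R)
    (X D : 'cV[R[i]]_n) : A \is hermsymmx ->
  dirD (objective A alpha) X D =
    complex.Re ((D^t* *m A *m X) 0 0)
    + 4 * alpha * \sum_(j < n) normc (X j 0) ^+ 2
                              * complex.Re ((X j 0)^* * D j 0).
Proof.
move=> hA; have [q E] := objective_line alpha X D hA.
rewrite /dirD E -derivE !(derivD, derivM, derivC, derivX, derivXn).
by rewrite !(hornerD, hornerM, hornerC, hornerXn, hornerX, horner0); ring.
Qed.

Lemma dirD2_objective (R : realType) (n : nat) (A : 'M[R[i]]_n) (alpha : R)
    (X D : 'cV[R[i]]_n) : A \is hermsymmx ->
  dirD2 (objective A alpha) X D =
    complex.Re ((D^t* *m A *m D) 0 0)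
    + 4 * alpha * \sum_(j < n)
        (normc (X j 0) ^+ 2 * normc (D j 0) ^+ 2
         + 2 * complex.Re ((X j 0)^* * D j 0) ^+ 2).
Proof.
move=> hA; have [q E] := objective_line alpha X D hA.
rewrite /dirD2 E /derive1n /= -!derivE.
rewrite !(derivD, derivM, derivC, derivX, derivXn, deriv0).
rewrite !(hornerD, hornerM, hornerC, hornerXn, hornerX, horner0).
by field.
Qed.

Lemma dirD_objective_grad (R : realType) (n : nat) (A : 'M[R[i]]_n)
    (alpha : R) (X D : 'cV[R[i]]_n) : A \is hermsymmx ->
  dirD (objective A alpha) X D =
    complex.Re ((D^t* *m grad A alpha X) 0 0).
Proof.
move=> hA; rewrite dirD_objective// -mulmxA.
rewrite [(_ *m (A *m X)) 0 0]mxE [(_ *m grad _ _ _) 0 0]mxE.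
rewrite !raddf_sum /= mulr_sumr -big_split /=; apply: eq_bigr => j _.
rewrite !mxE; move: (\sum_(_ < _) _) (normc _ ^+ 2) => [u v] m.
by case: (X j 0) (D j 0) => [a b] [c d] /=; ring.
Qed.

(* Main.v *)
Require Import Defs.
From mathcomp Require Import all_boot all_order all_algebra.
From mathcomp Require Import complex.
From mathcomp Require Import all_classical all_reals all_analysis.
From mathcomp Require Import ring lra.

Set Implicit Arguments.
Unset Strict Implicit.
Unset Printing Implicit Defensive.

Import Order.TTheory GRing.Theory Num.Theory.
Import numFieldNormedType.Exports.

Local Open Scope classical_set_scope.
Local Open Scope sesquilinear_scope.
Local Open Scope complex_scope.
Local Open Scope ring_scope.

(** Write [F] for the objective, [g X] for [calA A alpha X *m X] and [<X, Y>]
for the real inner product [Re (X^* Y)].  On the unit sphere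
[g X = G - <X, G> X], with [G] the gradient of [F] at [X]: it is the tangential
part of the gradient, so the residual measures first-order stationarity.  The
number [X^* G] is real because [A] is Hermitian, and this is what identifies
the complex and the real orthogonal projections.

One constant [K] bounds everything on the sphere: the gradient by [K], the
Hessian by [3 K], the error of the second-order Taylor expansion between two
feasible points by [3 K |D|^2], and [F] from below by [- K].

- The minimal value of the model is at most [- |g|^2 / (4 (4 K + delta))]
  ([model_descent]); a single trial point on the circle through [X] and
  [- g / |g|] shows it.
- When [delta >= 6 K], the regularization term absorbs the Taylor error, so
  that the decrease of [F] is at least the one predicted by the model: the
  ratio is at least 1 ([ratio_ge1]) and [delta] is not increased.  As one step
  multiplies [delta] by at most [gamma2], the sequence [delta] stays bounded
  ([regularization_bounded]).
- Hence a successful step decreases [F] by at least a fixed multiple of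
  [|g|^2] ([success_descent]), while an unsuccessful one keeps the iterate and
  multiplies [delta] by at least [gamma1 > 1].  The latter cannot go on forever
  with [delta] bounded, so every iterate is eventually left by a successful
  step.  Since [F] decreases and is bounded below, its decrements, and with
  them the residuals, tend to 0 ([regularized_descent_cvg0]).

If no residual vanishes, all model values at the minimizers are negative and
the argument applies at every step. *)

(** * Scalar sequences of a regularized descent method *)

(** Above the threshold [B] the parameter cannot grow, and from below [B] one
step leads to at most [gamma * B]. *)
Lemma regularization_bounded (R : realFieldType) (d : nat -> R) (B gamma : R) :
  1 <= gamma -> (forall k, 0 < d k) ->
  (forall k, d k.+1 <= gamma * d k) ->
  (forall k, B <= d k -> d k.+1 <= d k) ->
  forall k, d k <= Num.max (d 0%N) (gamma * B).
Proof.
move=> g1 d0 dgamma dB; elim=> [|k IHk]; first by rewrite le_max lexx.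
have [Bd|dlt] := leP B (d k); first exact: le_trans (dB _ Bd) IHk.
rewrite le_max; apply/orP; right; apply: le_trans (dgamma k) _.
by rewrite ler_pM2l ?(ltW dlt)// (lt_le_trans ltr01).
Qed.

(** If all steps from [k] on failed, [d] would grow without bound.  The value of
[g] is carried along because failed steps leave it unchanged, so that a bound
on [g] at successful steps is a bound on [g] at all steps. *)
Lemma exists_later_success (R : realType) (g d : nat -> R) (ok : nat -> bool)
    (gamma D : R) : 1 < gamma ->
  (forall k, 0 < d k <= D) ->
  (forall k, ~~ ok k -> g k.+1 = g k /\ gamma * d k <= d k.+1) ->
  forall k, exists k', [/\ (k <= k')%N, ok k' & g k' = g k].
Proof.
move=> g1 dD fail k; apply: contrapT => none.
(* Geometric growth is more than needed: arithmetic growth, with the increment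
   of the first step, already exceeds any bound. *)
have grow j : g (k + j)%N = g k /\
    d k + j%:R * ((gamma - 1) * d k) <= d (k + j)%N.
  elim: j => [|j [IHg IHd]]; first by rewrite addn0 mul0r addr0.
  have nok : ~~ ok (k + j)%N.
    by apply/negP => okj; apply: none; exists (k + j)%N; rewrite leq_addr.
  have [Eg Ed] := fail _ nok; rewrite addnS Eg IHg; split => //.
  have /andP[dk0 _] := dD k.
  have c0 : 0 <= j%:R * ((gamma - 1) * d k).
    by rewrite !mulr_ge0 ?subr_ge0 ?(ltW g1)// ltW.
  rewrite -natr1 mulrDl mul1r; apply: le_trans Ed.
  move: (j%:R * _) IHd c0 => c IHd c0.
  apply: (@le_trans _ _ (gamma * (d k + c))); last first.
    by rewrite ler_pM2l// (lt_trans ltr01).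
  by nra.
have /andP[dk0 _] := dD k.
have c0 : 0 < (gamma - 1) * d k by rewrite mulr_gt0 ?subr_gt0.
have := archi_boundP (ltW (divr_gt0 (lt_le_trans dk0 (andP (dD k)).2) c0)).
set j := Num.bound _; rewrite ltr_pdivrMr// => Dj.
have [_ dj] := grow j; have /andP[_ dDj] := dD (k + j)%N.
by have := le_lt_trans (le_trans dj dDj) Dj; rewrite gtrDr ltNge ltW.
Qed.

(** The convergence mechanism, free of any geometry: [f] is the objective, [g]
the residual, [d] the regularization parameter and [ok] tells which steps are
successful.  [f] tends to its infimum; a successful step taken within
[c * e ^+ 2] of it must have a residual below [e]. *)
Lemma regularized_descent_cvg0 (R : realType) (f g d : nat -> R)
    (ok : nat -> bool) (gamma D c m : R) : 1 < gamma -> 0 < c ->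
  (forall k, 0 < d k <= D) -> (forall k, m <= f k) -> (forall k, 0 <= g k) ->
  (forall k, ok k -> f k.+1 <= f k - c * g k ^+ 2) ->
  (forall k, ~~ ok k -> [/\ f k.+1 = f k, g k.+1 = g k
                          & gamma * d k <= d k.+1]) ->
  g @ \oo --> (0 : R).
Proof.
move=> g1 c0 dD mf g0 good bad.
have dec : {homo f : n k / (n <= k)%N >-> k <= n}.
  apply/nonincreasing_seqP => k; case: (boolP (ok k)) => [/good|/bad[->]//].
  by move=> /le_trans; apply; rewrite gerBl mulr_ge0 ?sqr_ge0// ltW.
have flb : has_lbound (range f) by exists m => _ [k _ <-].
have flim := nonincreasing_cvgn dec flb.
apply/cvgr0Pnorm_lt => e e0.
have ce0 : 0 < c * e ^+ 2 by rewrite mulr_gt0// exprn_gt0.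
have /cvgrPdist_lt/(_ _ ce0) := flim.
apply: filterS => k; rewrite distrC => fk.
have later : forall j, ~~ ok j -> g j.+1 = g j /\ gamma * d j <= d j.+1.
  by move=> j /bad[].
have [k' [kk' okk' <-]] := exists_later_success g1 dD later k.
rewrite ger0_norm// -(@ltr_pXn2r _ 2) ?nnegrE ?(ltW e0)//.
rewrite -(ltr_pM2l c0); apply: le_lt_trans fk.
apply: le_trans (ler_norm _).
have infle : inf (range f) <= f k'.+1 by apply: ge_inf => //; exists k'.+1.
by have := good _ okk'; have := dec _ _ kk'; lra.
Qed.

(** * The real Euclidean structure of complex vectors *)

Section RealComplex.
Context (R : realType).
Implicit Types (z w : R[i]).

Lemma ReD z w : complex.Re (z + w) = complex.Re z + complex.Re w.
Proof. by case: z w => [? ?] []. Qed.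

Lemma ReZ (t : R) z : complex.Re (t%:C * z) = t * complex.Re z.
Proof. by case: z => a b /=; ring. Qed.

Lemma normc_ge0 z : 0 <= Normc.normc z.
Proof. by case: z => a b; rewrite sqrtr_ge0. Qed.

Lemma normc_conj z : Normc.normc z^* = Normc.normc z.
Proof. by case: z => a b /=; rewrite sqrrN. Qed.

Lemma normr_Re_le z : `|complex.Re z| <= Normc.normc z.
Proof. by have := normc_ge_Re z; rewrite normc_def lecR; case: z. Qed.

Lemma normr_Re_conjM_le z w :
  `|complex.Re (z^* * w)| <= Normc.normc z * Normc.normc w.
Proof.
by apply: le_trans (normr_Re_le _) _; rewrite Normc.normcM normc_conj.
Qed.

Lemma le_normc_sum (I : finType) (F : I -> R[i]) :
  Normc.normc (\sum_j F j) <= \sum_j Normc.normc (F j).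
Proof.
elim/big_ind2: _ => [|x1 x2 y1 y2 h1 h2|//]; first by rewrite Normc.normc0.
exact: le_trans (le_normcD _ _) (lerD h1 h2).
Qed.

End RealComplex.

Definition dotr (R : realType) n (X Y : 'cV[R[i]]_n) : R :=
  complex.Re ((X^t* *m Y) 0 0).

Section Euclidean.
Context (R : realType) (n : nat).
Implicit Types (X Y Z : 'cV[R[i]]_n) (t : R).

Lemma dotrE X Y : dotr X Y = \sum_j complex.Re ((X j 0)^* * Y j 0).
Proof.
by rewrite /dotr mxE raddf_sum; apply: eq_bigr => j _; rewrite !mxE.
Qed.

Lemma dotrC X Y : dotr X Y = dotr Y X.
Proof.
rewrite !dotrE; apply: eq_bigr => j _.
by case: (X j 0) (Y j 0) => [a b] [c d] /=; ring.
Qed.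

Lemma dotrDr X Y Z : dotr X (Y + Z) = dotr X Y + dotr X Z.
Proof. by rewrite /dotr mulmxDr mxE ReD. Qed.

Lemma dotrZr t X Y : dotr X (t%:C *: Y) = t * dotr X Y.
Proof. by rewrite /dotr -scalemxAr mxE ReZ. Qed.

Lemma dotrDl X Y Z : dotr (X + Y) Z = dotr X Z + dotr Y Z.
Proof. by rewrite dotrC dotrDr !(dotrC Z). Qed.

Lemma dotrZl t X Y : dotr (t%:C *: X) Y = t * dotr X Y.
Proof. by rewrite dotrC dotrZr dotrC. Qed.

Lemma l2norm_sqr_sum X : l2norm X ^+ 2 = \sum_j Normc.normc (X j 0) ^+ 2.
Proof. by rewrite sqr_sqrtr// sumr_ge0// => j _; exact: sqr_ge0. Qed.

Lemma l2norm_sqr X : l2norm X ^+ 2 = dotr X X.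
Proof.
rewrite l2norm_sqr_sum dotrE; apply: eq_bigr => j _.
by rewrite Defs.sqr_normc; case: (X j 0) => a b /=; ring.
Qed.

Lemma l2norm_sqrD X Y :
  l2norm (X + Y) ^+ 2 = l2norm X ^+ 2 + 2 * dotr X Y + l2norm Y ^+ 2.
Proof. by rewrite !l2norm_sqr !dotrDl !dotrDr (dotrC Y X); ring. Qed.

Lemma l2norm_ge0 X : 0 <= l2norm X.
Proof. exact: sqrtr_ge0. Qed.

Lemma l2norm0 : l2norm (0 : 'cV[R[i]]_n) = 0.
Proof.
rewrite /l2norm big1 ?sqrtr0// => j _.
by rewrite mxE Normc.normc0 expr0n.
Qed.

Lemma normc_le_l2norm X j : Normc.normc (X j 0) <= l2norm X.
Proof.
rewrite -(@ler_pXn2r _ 2) ?nnegrE ?normc_ge0 ?l2norm_ge0//.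
rewrite l2norm_sqr_sum (bigD1 j)//= lerDl sumr_ge0// => ? _.
exact: sqr_ge0.
Qed.

Lemma mulmx_conjt_self X : (X^t* *m X) 0 0 = (l2norm X ^+ 2)%:C.
Proof.
rewrite l2norm_sqr_sum mxE rmorph_sum /=; apply: eq_bigr => j _.
rewrite !mxE Defs.sqr_normc; case: (X j 0) => a b.
by apply/eqP; rewrite eq_complex /=; apply/andP; split; apply/eqP; ring.
Qed.

(** The sum of the moduli of the entries is a crude operator norm, but any
constant serves, and this one needs only that an entry of a vector is bounded
by its norm. *)
Lemma normr_form_le (A : 'M[R[i]]_n) X Y :
  `|complex.Re ((X^t* *m A *m Y) 0 0)| <=
    (\sum_i \sum_j Normc.normc (A i j)) * (l2norm X * l2norm Y).
Proof.
apply: le_trans (normr_Re_le _) _.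
rewrite -mulmxA mxE; apply: le_trans (le_normc_sum _) _.
rewrite mulr_suml; apply: ler_sum => i _.
rewrite !mxE Normc.normcM normc_conj mulr_suml.
apply: (@le_trans _ _ (Normc.normc (X i 0) *
    \sum_j Normc.normc (A i j * Y j 0))).
  by apply: ler_wpM2l; [exact: normc_ge0|exact: le_normc_sum].
rewrite mulr_sumr; apply: ler_sum => j _.
rewrite Normc.normcM mulrCA; apply: ler_wpM2l; first exact: normc_ge0.
by apply: ler_pM; rewrite ?normc_ge0 ?normc_le_l2norm.
Qed.

End Euclidean.

(** * Uniform bounds on the objective over the unit sphere *)

(** Chosen so that the gradient is bounded by it, and both the Hessian and the
second-order Taylor error by a small multiple of it, on the unit sphere. *)
Definition derivative_bound (R : realType) n (A : 'M[R[i]]_n) (alpha : R) : R :=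
  (\sum_i \sum_j Normc.normc (A i j)) + 4 * `|alpha|.

Section Objective.
Context (R : realType) (n : nat) (A : 'M[R[i]]_n) (alpha : R)
  (hA : A \is hermsymmx).
Implicit Types (X Y Z D : 'cV[R[i]]_n) (delta t : R).

Local Notation F := (objective A alpha).
Local Notation G := (grad A alpha).
Local Notation K := (derivative_bound A alpha).

Lemma entry_sum_ge0 : 0 <= \sum_i \sum_j Normc.normc (A i j).
Proof. by do 2![apply: sumr_ge0 => ? _]; exact: normc_ge0. Qed.

Lemma derivative_bound_ge_alpha : 4 * `|alpha| <= K.
Proof. by rewrite lerDr entry_sum_ge0. Qed.

Lemma derivative_bound_ge0 : 0 <= K.
Proof. by apply: le_trans derivative_bound_ge_alpha; rewrite mulr_ge0. Qed.

Lemma normc_le1 X j : l2norm X = 1 -> Normc.normc (X j 0) <= 1.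
Proof. by move=> <-; exact: normc_le_l2norm. Qed.

Lemma normr_dirD_le X D : l2norm X = 1 -> `|dirD F X D| <= K * l2norm D.
Proof.
move=> X1; rewrite dirD_objective// /derivative_bound [leRHS]mulrDl.
apply: le_trans (ler_normD _ _) _; apply: lerD.
  by have := normr_form_le A D X; rewrite X1 mulr1.
rewrite !normrM ger0_norm// -mulrA -[leRHS]mulrA ler_wpM2l// ler_wpM2l//.
apply: le_trans (ler_norm_sum _ _ _) _.
rewrite -[leRHS]mul1r -[X in X * _](expr1n _ 2) -X1 l2norm_sqr_sum mulr_suml.
apply: ler_sum => j _.
rewrite normrM ger0_norm ?sqr_ge0// ler_wpM2l ?sqr_ge0//.
apply: le_trans (normr_Re_conjM_le _ _) _; rewrite -[leRHS]mul1r.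
by rewrite ler_pM ?normc_ge0 ?normc_le_l2norm ?normc_le1.
Qed.

Lemma normr_dirD2_le X D : l2norm X = 1 ->
  `|dirD2 F X D| <= 3 * K * l2norm D ^+ 2.
Proof.
move=> X1; rewrite dirD2_objective// /derivative_bound.
have -> (a b c : R) : 3 * (a + b) * c = 3 * (a * c) + b * (3 * c) by ring.
apply: le_trans (ler_normD _ _) _; apply: lerD.
  apply: le_trans (normr_form_le A D D) _; rewrite -expr2.
  by rewrite ler_peMl ?ler1n// mulr_ge0 ?sqr_ge0 ?entry_sum_ge0.
rewrite !normrM ger0_norm// ler_wpM2l ?mulr_ge0//.
apply: le_trans (ler_norm_sum _ _ _) _.
rewrite l2norm_sqr_sum mulr_sumr; apply: ler_sum => j _.
have x1 := normc_le1 j X1; have x0 := normc_ge0 (X j 0).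
have d0 := normc_ge0 (D j 0).
have x2 : Normc.normc (X j 0) ^+ 2 <= 1 by rewrite expr_le1.
have r2 : complex.Re ((X j 0)^* * D j 0) ^+ 2
    <= Normc.normc (X j 0) ^+ 2 * Normc.normc (D j 0) ^+ 2.
  rewrite -exprMn -real_normK ?num_real//.
  by rewrite ler_pXn2r ?nnegrE ?mulr_ge0 ?normr_Re_conjM_le.
have d2 := sqr_ge0 (Normc.normc (D j 0)).
have xd : Normc.normc (X j 0) ^+ 2 * Normc.normc (D j 0) ^+ 2
    <= Normc.normc (D j 0) ^+ 2 by rewrite ler_piMl.
rewrite ger0_norm; last first.
  by apply: addr_ge0; apply: mulr_ge0 => //; exact: sqr_ge0.
lra.
Qed.

Lemma objective_ge X : l2norm X = 1 -> - K <= F X.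
Proof.
move=> X1; rewrite lerNl; apply: le_trans (ler_norm _) _.
rewrite normrN /objective /derivative_bound.
apply: le_trans (ler_normD _ _) _; apply: lerD.
  rewrite normrM ger0_norm ?invr_ge0//; have := normr_form_le A X X.
  have := entry_sum_ge0; rewrite X1 !mulr1; lra.
rewrite normrM mulrC ler_wpM2r// ger0_norm; last first.
  by apply: sumr_ge0 => j _; rewrite exprn_ge0 ?normc_ge0.
apply: (@le_trans _ _ 1); last by rewrite ler1n.
rewrite -[leRHS](expr1n _ 2) -X1 l2norm_sqr_sum; apply: ler_sum => j _.
by rewrite ler_wiXn2l ?normc_ge0 ?normc_le1.
Qed.

(** The objective is a quartic polynomial, so its Taylor error is explicit: the
cubic and quartic terms come from the moduli to the fourth power. *)
Lemma objective_taylor X D :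
  F (X + D) - F X - dirD F X D - 2^-1 * dirD2 F X D =
    alpha * \sum_j (4 * Normc.normc (D j 0) ^+ 2
                      * complex.Re ((X j 0)^* * D j 0)
                    + Normc.normc (D j 0) ^+ 4).
Proof.
rewrite dirD_objective// dirD2_objective// /objective.
have := form_line X D 1 hA; rewrite !scale1r => ->.
have -> : \sum_(j < n) Normc.normc ((X + D) j 0) ^+ 4 =
   \sum_(j < n) Normc.normc (X j 0) ^+ 4
   + 4 * (\sum_(j < n) Normc.normc (X j 0) ^+ 2
                           * complex.Re ((X j 0)^* * D j 0))
   + 2 * (\sum_(j < n) (Normc.normc (X j 0) ^+ 2 * Normc.normc (D j 0) ^+ 2
              + 2 * complex.Re ((X j 0)^* * D j 0) ^+ 2))
   + \sum_j (4 * Normc.normc (D j 0) ^+ 2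
                      * complex.Re ((X j 0)^* * D j 0)
                    + Normc.normc (D j 0) ^+ 4).
  rewrite !mulr_sumr -!big_split /=; apply: eq_bigr => j _.
  have := sqr_normc_line (X j 0) (D j 0) 1; rewrite mul1r !mxE => E.
  by rewrite -[4%N]/(2 * 2)%N exprM E !exprM; ring.
by field.
Qed.

(** Both points being on the sphere, the entries of [D] are at most 2, which
turns the cubic and quartic terms into multiples of [|D|^2].  A quadratic bound
is what a regularization term of the form [delta / 2 * |D|^2] can absorb. *)
Lemma taylor_remainder_le X D : l2norm X = 1 -> l2norm (X + D) = 1 ->
  F (X + D) - F X - dirD F X D - 2^-1 * dirD2 F X D
    <= 3 * K * l2norm D ^+ 2.
Proof.
move=> X1 XD1; rewrite objective_taylor; apply: le_trans (ler_norm _) _.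
apply: (@le_trans _ _ (`|alpha| * (12 * l2norm D ^+ 2))); last first.
  rewrite mulrA ler_wpM2r ?sqr_ge0//; have := derivative_bound_ge_alpha; lra.
rewrite normrM ler_wpM2l//; apply: le_trans (ler_norm_sum _ _ _) _.
rewrite l2norm_sqr_sum mulr_sumr; apply: ler_sum => j _.
have x1 := normc_le1 j X1; have xd1 := normc_le1 j XD1.
have d0 := normc_ge0 (D j 0).
have d2 : Normc.normc (D j 0) <= 2.
  have -> : D j 0 = (X + D) j 0 + - X j 0 by rewrite !mxE; ring.
  apply: le_trans (le_normcD _ _) _; rewrite normcN; lra.
have re : `|complex.Re ((X j 0)^* * D j 0)| <= 2.
  apply: le_trans (normr_Re_conjM_le _ _) _.
  by rewrite -[leRHS]mul1r ler_pM ?normc_ge0.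
set d := Normc.normc (D j 0) in d0 d2 *; set r := complex.Re _ in re *.
have -> : 4 * d ^+ 2 * r + d ^+ 4 = d ^+ 2 * (4 * r + d ^+ 2) by ring.
rewrite normrM [`|d ^+ 2|]ger0_norm ?sqr_ge0// mulrC ler_wpM2r ?sqr_ge0//.
apply: le_trans (ler_normD _ _) _; rewrite normrM (ger0_norm (sqr_ge0 _)).
rewrite [`|4|]ger0_norm//; nra.
Qed.

End Objective.

(** * The regularized model on the unit sphere *)

Section SphereModel.
Context (R : realType) (n : nat) (A : 'M[R[i]]_n) (alpha : R)
  (hA : A \is hermsymmx).
Implicit Types (X Y Z D : 'cV[R[i]]_n) (delta : R).

Local Notation F := (objective A alpha).
Local Notation G := (grad A alpha).
Local Notation K := (derivative_bound A alpha).
Local Notation g X := (calA A alpha X *m X).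

Lemma Im_form_herm X : complex.Im ((X^t* *m A *m X) 0 0) = 0.
Proof.
have : X^t* *m A *m X = (X^t* *m A *m X)^t*.
  have /is_hermitianmxP := hA; rewrite expr0 scale1r => hA'.
  rewrite !trmx_mul !map_mxM /= -mulmxA; congr (_ *m _).
  rewrite [in LHS]hA'; congr (_ *m _).
  by apply/matrixP => i j; rewrite !mxE conjCK.
move=> /(congr1 (fun B : 'M[R[i]]_1 => complex.Im (B 0 0))).
by rewrite [in RHS]mxE [in RHS]mxE; case: ((X^t* *m A *m X) 0 0) => a b /=; lra.
Qed.

(** The gradient is [(A + diag c) X] with [c] real, hence a Hermitian form
evaluated at [X]. *)
Lemma mulmx_grad_real X : ((G X)^t* *m X) 0 0 = (dotr X (G X))%:C.
Proof.
have ImD (z w : R[i]) : complex.Im (z + w) = complex.Im z + complex.Im w.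
  by case: z w => [? ?] [].
have conjE : ((G X)^t* *m X) 0 0 = ((X^t* *m G X) 0 0)^*.
  rewrite !mxE rmorph_sum; apply: eq_bigr => j _.
  by rewrite !mxE rmorphM /= conjCK mulrC.
have Im0 : complex.Im ((X^t* *m G X) 0 0) = 0.
  have -> : G X = A *m X + \col_j
      ((4 * alpha * Normc.normc (X j 0) ^+ 2)%:C * X j 0).
    by apply/matrixP => i j; rewrite !mxE !ord1.
  rewrite mulmxDr mulmxA mxE ImD Im_form_herm add0r mxE raddf_sum /=.
  apply: big1 => j _; rewrite !mxE; move: (4 * _ * _) => c.
  by case: (X j 0) => a b /=; ring.
rewrite conjE /dotr; case: ((X^t* *m G X) 0 0) Im0 => a b /= ->.
by apply/eqP; rewrite eq_complex /= oppr0 !eqxx.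
Qed.

(** On the sphere the residual vector is the projection of the gradient onto the
tangent space. *)
Lemma calA_mulmx X : l2norm X = 1 -> g X = G X - (dotr X (G X))%:C *: X.
Proof.
move=> X1; rewrite /calA mulmxBl -!mulmxA.
rewrite [X^t* *m X]mx11_scalar mulmx_conjt_self X1 expr1n mulmx1.
by rewrite [_^t* *m X]mx11_scalar mulmx_grad_real mul_mx_scalar.
Qed.

Lemma grad_split X : l2norm X = 1 -> G X = g X + (dotr X (G X))%:C *: X.
Proof. by move=> /calA_mulmx ->; rewrite subrK. Qed.

Lemma dotr_calA X : l2norm X = 1 -> dotr X (g X) = 0.
Proof.
move=> X1; have := congr1 (dotr X) (grad_split X1).
by rewrite dotrDr dotrZr -l2norm_sqr X1; lra.
Qed.

Lemma dotr_calA_grad X : l2norm X = 1 -> dotr (g X) (G X) = l2norm (g X) ^+ 2.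
Proof.
move=> X1; rewrite [in LHS](grad_split X1) dotrDr dotrZr (dotrC _ X).
by rewrite dotr_calA// mulr0 addr0 l2norm_sqr.
Qed.

Lemma dirD_dotr X D : dirD F X D = dotr D (G X).
Proof. exact: dirD_objective_grad. Qed.

Lemma l2norm_calA_le X : l2norm X = 1 -> l2norm (g X) <= K.
Proof.
move=> X1; have := normr_dirD_le alpha hA (g X) X1.
rewrite dirD_dotr dotr_calA_grad// normrX ger0_norm ?l2norm_ge0//.
have := l2norm_ge0 (g X); rewrite le_eqVlt => /predU1P[<- _|g0].
  exact: derivative_bound_ge0.
by rewrite expr2 ler_pM2r.
Qed.

Lemma model_self X delta : l2norm X = 1 -> model A alpha X delta X = 0.
Proof.
move=> X1; rewrite /model subrr l2norm0 expr0n mulr0 addr0.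
have := normr_dirD_le alpha hA 0 X1; have := normr_dirD2_le alpha hA 0 X1.
rewrite l2norm0 expr0n !mulr0 !normr_le0 => /eqP-> /eqP->.
by rewrite mulr0 addr0.
Qed.

(** It is enough to exhibit one good feasible point.  Take [Y = c X - u g] with
[c^2 + (u |g|)^2 = 1]: the first-order term contributes [- u |g|^2], and all
other terms are at most [(1 - c) (4 K + delta)], which is of order
[(u |g|)^2].  Balancing the two gives [u = 1 / (2 (4 K + delta))]. *)
Lemma model_descent X Z delta : 0 < delta -> l2norm X = 1 ->
  sphere_argmin (model A alpha X delta) Z ->
  model A alpha X delta Z <= - l2norm (g X) ^+ 2 / (4 * (4 * K + delta)).
Proof.
move=> d0 X1 [_ minZ].
have K0 := derivative_bound_ge0 A alpha; have gK := l2norm_calA_le X1.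
have gam0 := l2norm_ge0 (g X); set gam := l2norm (g X) in gam0 gK *.
set N := 4 * K + delta; have N0 : 0 < N by rewrite /N; lra.
pose u := (2 * N)^-1; have u0 : 0 < u by rewrite invr_gt0; lra.
have uN : u * N = 2^-1 by rewrite /u; field; rewrite gt_eqF.
pose s := u * gam; have s0 : 0 <= s by rewrite mulr_ge0 // ltW.
(* [4 K + delta >= |g|] makes the step short enough for [c] to exist. *)
have s1 : s <= 1.
  rewrite (@le_trans _ _ (u * N))//; last by rewrite uN; lra.
  by rewrite ler_pM2l // /N; lra.
pose c := Num.sqrt (1 - s ^+ 2).
have c2 : c ^+ 2 = 1 - s ^+ 2 by rewrite sqr_sqrtr // subr_ge0 expr_le1.
have c0 : 0 <= c by exact: sqrtr_ge0.
have c1 : c <= 1 by nra.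
have cs : 1 - c <= s ^+ 2 by nra.
pose D := (c - 1)%:C *: X + (- u)%:C *: g X.
have dXg := dotr_calA X1; have dgX : dotr (g X) X = 0 by rewrite dotrC.
have DD : l2norm D ^+ 2 = 2 * (1 - c).
  rewrite l2norm_sqr /D !(dotrDr, dotrDl, dotrZr, dotrZl) dXg dgX.
  rewrite -!l2norm_sqr X1 -/gam; move: c2; rewrite /s; lra.
have Y1 : l2norm (X + D) = 1.
  apply/eqP; rewrite -(@eqrXn2 _ 2) ?l2norm_ge0// expr1n l2norm_sqrD X1 DD.
  rewrite /D !(dotrDr, dotrZr) dXg -l2norm_sqr X1; apply/eqP; ring.
apply: le_trans (minZ _ Y1) _; rewrite /model [X + D]addrC addrK.
have D1 : dirD F X D <= (1 - c) * K - u * gam ^+ 2.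
  rewrite dirD_dotr /D dotrDl !dotrZl dotr_calA_grad// -/gam.
  have := normr_dirD_le alpha hA X X1; rewrite X1 mulr1 dirD_dotr.
  by rewrite ler_norml => /andP[lo _]; nra.
have D2 : dirD2 F X D <= 3 * K * (2 * (1 - c)).
  by rewrite -DD; apply: le_trans (ler_norm _) (normr_dirD2_le _ _ _ _).
have -> : - gam ^+ 2 / (4 * N) = s ^+ 2 * N - u * gam ^+ 2.
  by rewrite /s /u; field; rewrite gt_eqF.
rewrite DD; have : (1 - c) * N <= s ^+ 2 * N by rewrite ler_pM2r.
rewrite /N; lra.
Qed.

(** The regularization term of the model dominates the Taylor error, so the
model overestimates the objective; dividing by the negative model value turns
this into a lower bound on the ratio. *)
Lemma ratio_ge1 X Z delta : l2norm X = 1 -> l2norm Z = 1 -> 6 * K <= delta ->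
  model A alpha X delta Z < 0 -> 1 <= Defs.ratio A alpha X delta Z.
Proof.
move=> X1 Z1 dK W0; rewrite /Defs.ratio model_self// subr0 ler_ndivlMr// mul1r.
have XZ : X + (Z - X) = Z by rewrite addrC subrK.
have := taylor_remainder_le (D := Z - X) alpha hA X1.
rewrite XZ => /(_ Z1); rewrite /model.
have := sqr_ge0 (l2norm (Z - X)); nra.
Qed.

Lemma success_descent X Z delta eta : 0 <= eta -> 0 < delta -> l2norm X = 1 ->
  sphere_argmin (model A alpha X delta) Z -> model A alpha X delta Z < 0 ->
  eta <= Defs.ratio A alpha X delta Z ->
  F Z <= F X - eta * (l2norm (g X) ^+ 2 / (4 * (4 * K + delta))).
Proof.
move=> eta0 d0 X1 minZ W0; rewrite /Defs.ratio model_self// subr0 ler_ndivlMr//.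
have := ler_wpM2l eta0 (model_descent d0 X1 minZ); rewrite mulNr; lra.
Qed.

End SphereModel.

(** * Convergence of the regularized Newton method *)

Theorem theorem3p6 (R : realType) (M : nat) (hM : (0 < M)%N)
    (alpha : R) (A : 'M[R[i]]_M) (hA : A \is hermsymmx)
    (eta1 eta2 gamma1 gamma2 : R)
    (heta1 : 0 < eta1) (heta12 : eta1 <= eta2) (heta2 : eta2 < 1)
    (hgamma1 : 1 < gamma1) (hgamma12 : gamma1 <= gamma2)
    (X Z : nat -> 'cV[R[i]]_M) (delta : nat -> R)
    (hrun : newton_run A alpha eta1 eta2 gamma1 gamma2 X Z delta) :
  (exists k : nat, l2norm (calA A alpha (X k) *m X k) = 0) \/
  (fun k : nat => l2norm (calA A alpha (X k) *m X k)) @ \oo --> (0 : R).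
Proof.
case: hrun => _ delta00 X1 delta1 argminZ Xstep dstep.
have [|nz] := pselect (exists k, l2norm (calA A alpha (X k) *m X k) = 0).
  by left.
(* The first iterate comes from the initial phase, so the sequences are shifted
   to start after it. *)
right; rewrite -cvg_shiftS.
pose g k := l2norm (calA A alpha (X k.+1) *m X k.+1).
pose d k := delta k.+1.
pose rho k := Defs.ratio A alpha (X k.+1) (delta k.+1) (Z k.+1).
have {}argminZ k := argminZ k.+1 isT.
have {}Xstep k : X k.+2 = if eta1 <= rho k then Z k.+1 else X k.+1.
  exact: Xstep.
have {}dstep k := dstep k.+1 isT; rewrite /= in dstep.
have g_gt0 k : 0 < g k.
  by rewrite lt0r l2norm_ge0 andbT; apply/eqP => g0; apply: nz; exists k.+1.
have feas k : l2norm (X k.+1) = 1.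
  by elim: k => // k IHk; rewrite Xstep; case: ifP => // _; case: (argminZ k).
have d_gt0 k : 0 < d k.
  elim: k => [|k IHk]; first by rewrite /d delta1.
  have := dstep k; rewrite -/(rho k) -/(d k) -/(d k.+1).
  case: ifP => [_ /andP[]//|_]; case: ifP => _ /andP[+ _].
    exact: lt_le_trans.
  by apply: lt_le_trans; rewrite mulr_gt0// (lt_trans ltr01).
have K0 := derivative_bound_ge0 A alpha.
set K := derivative_bound A alpha in K0.
have W_lt0 k : model A alpha (X k.+1) (delta k.+1) (Z k.+1) < 0.
  apply: le_lt_trans (model_descent hA (d_gt0 k) (feas k) (argminZ k)) _.
  rewrite mulNr oppr_lt0 divr_gt0 ?exprn_gt0 ?g_gt0//.
  by have := d_gt0 k; rewrite -/K /d; lra.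
have d_le k : d k <= Num.max (d 0%N) (gamma2 * (6 * K)).
  apply: regularization_bounded => // [|j|j Kd]; first lra.
    have := dstep j; rewrite -/(rho j) -/(d j) -/(d j.+1).
    have := d_gt0 j.
    by case: ifP => _; [|case: ifP => _] => dj /andP[_] /le_trans; apply; nra.
  have rho1 : 1 <= rho j.
    by apply: ratio_ge1 => //; case: (argminZ j).
  have := dstep j; rewrite -/(rho j) (lt_le_trans heta2 rho1).
  by case/andP.
set D := Num.max _ _ in d_le.
have N0 : 0 < 4 * K + D by have := d_gt0 0%N; have := d_le 0%N; lra.
apply: (@regularized_descent_cvg0 _ (fun k => objective A alpha (X k.+1)) g d
  (fun k => eta1 <= rho k) gamma1 D (eta1 / (4 * (4 * K + D))) (- K)) => //.
- by rewrite divr_gt0 ?mulr_gt0.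
- by move=> k; rewrite d_gt0 d_le.
- by move=> k; exact: objective_ge.
- by move=> k; exact: l2norm_ge0.
- move=> k ok; rewrite Xstep ok.
  apply: le_trans (success_descent hA (ltW heta1) (d_gt0 k) (feas k)
    (argminZ k) (W_lt0 k) ok) _.
  rewrite lerD2l lerN2 -mulrA ler_pM2l// mulrC ler_wpM2l ?sqr_ge0//.
  have := d_gt0 k; have := d_le k; rewrite -/K -/(d k) => dD dk0.
  by rewrite lef_pV2 ?posrE; lra.
- move=> k bad; rewrite /g Xstep (negbTE bad); split=> //.
  have := dstep k; rewrite -/(rho k) (negbTE bad) ifF; first by case/andP.
  by apply/negbTE; rewrite -leNgt (le_trans _ heta12)// ltW// ltNge.
Qed.
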